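(* Let $D$ be a two-dimensional regular local ring with fixed regular system of parameters $x,y$, let $0<a<b$ be real numbers, and let $I=[a,b]$. Then the interval ring $T_I$ is a local ring, with maximal ideal $M_I=\bigcap_{r\in I}M_r$, where $M_r$ is the maximal ideal of the monomial valuation ring $V_r$.
   Context: $D$ is a two-dimensional regular local ring with maximal ideal $\mathfrak m=(x,y)$ and quotient field $K$. Every nonzero element of $D$ can be written as $u_1\tau_1+\cdots+u_n\tau_n$ with $u_i$ units of $D$ and $\tau_i$ distinct monomials $x^py^q$ ($p,q\ge 0$ integers), none of which divides another in $D$; the set of monomials $\tau_i$ is uniquely determined by the element (and $x,y$). For real $r>0$, the monomial valuation $v_r$ on $K$ is defined by $v_r(0)=\infty$, $v_r(x^py^q)=p+qr$, $v_r(u_1\tau_1+\cdots+u_n\tau_n)=\min_i v_r(\tau_i)$ for such a representation, and $v_r(f/g)=v_r(f)-v_r(g)$ for $f,g\in D$, $g\neq 0$. Its valuation ring is $V_r=\{f\in K: v_r(f)\ge 0\}$, with maximal ideal $M_r=\{f\in K: v_r(f)>0\}$. For $I=[a,b]$ the interval ring $T_I$ is the intersection of all valuation rings $V$ such that $D\subseteq V\subseteq V_r$ for some $r\in I$. *)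

(* Defs.v *)
From HB Require Import structures.
From mathcomp Require Import all_boot all_order all_algebra ring_quotient.
From mathcomp Require Import boolp classical_sets set_interval reals constructive_ereal.

Set Implicit Arguments.
Unset Strict Implicit.
Unset Printing Implicit Defensive.

Import Order.TTheory GRing.Theory Num.Theory.
Local Open Scope classical_set_scope.
Local Open Scope ring_scope.

(* The rings V, V_r and T_I are subsets of the quotient field, so the notions
   below are relative to a subset A of an ambient ring; A := [set: R] gives
   the ring R itself. *)

Definition subring_of (R : nzRingType) (A : set R) : Prop :=
  GRing.subring_closed [in A].

Definition ideal_of (R : comNzRingType) (A J : set R) : Prop :=
  [/\ J `<=` A, J 0,
      (forall u v, J u -> J v -> J (u + v)) &
      (forall c u, A c -> J u -> J (c * u))].

Definition maximal_ideal_of (R : comNzRingType) (A M : set R) : Prop :=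
  [/\ ideal_of A M, M <> A &
      forall J, ideal_of A J -> M `<=` J -> J = M \/ J = A].

Definition local_ring (R : comNzRingType) (A M : set R) : Prop :=
  subring_of A /\ (forall N, maximal_ideal_of A N <-> N = M).

Definition ideal_gen (R : comNzRingType) (s : seq R) : set R :=
  [set z | exists c : 'I_(size s) -> R, z = \sum_i c i * s`_i].

Definition noetherian (R : comNzRingType) : Prop :=
  forall J : set R, ideal_of [set: R] J -> exists s : seq R, J = ideal_gen s.

(* idealr_closed contains the requirement that 1 is not in the ideal. *)
Definition prime_ideal (R : comNzRingType) (P : set R) : Prop :=
  idealr_closed [in P] /\ prime_idealr_closed [in P].

Definition prime_chain (R : comNzRingType) (n : nat) (P : 'I_n.+1 -> set R)
    : Prop :=
  (forall i, prime_ideal (P i)) /\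
  (forall i j : 'I_n.+1, (i < j)%N -> P i `<` P j).

Definition krull_dim (R : comNzRingType) (n : nat) : Prop :=
  (exists P : 'I_n.+1 -> set R, prime_chain P) /\
  (forall (k : nat) (P : 'I_k.+1 -> set R), prime_chain P -> (k <= n)%N).

(* R is a regular local ring of dimension (size s), and the entries of s
   generate its maximal ideal. *)
Definition regular_system_of_parameters (R : comNzRingType) (s : seq R)
    : Prop :=
  [/\ noetherian R, local_ring [set: R] (ideal_gen s) & krull_dim R (size s)].

Definition valuation_ring (K : fieldType) (V : set K) : Prop :=
  subring_of V /\ (forall z : K, z != 0 -> V z \/ V z^-1).

Section MonomialValuation.
Variables (R : realType) (D : idomainType) (x y : D).

Definition monomial (e : nat * nat) : D := x ^+ e.1 * y ^+ e.2.

Definition divides (u v : D) : Prop := exists c, v = c * u.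

Definition monomial_rep (f : D) (n : nat) (u : 'I_n -> D)
    (e : 'I_n -> nat * nat) : Prop :=
  [/\ f = \sum_i u i * monomial (e i),
      (forall i, u i \is a GRing.unit),
      injective (fun i => monomial (e i)) &
      (forall i j, i != j -> ~ divides (monomial (e i)) (monomial (e j)))].

Definition exponent_val (r : R) (e : nat * nat) : R := e.1%:R + e.2%:R * r.

(* v_r on D and on K; xget selects the common value of all representations
   (the default +oo is used only if there is none). *)
Definition monomial_valD (r : R) (f : D) : \bar R :=
  if f == 0 then +oo%E else
  xget +oo%E [set t | exists n (u : 'I_n -> D) (e : 'I_n -> nat * nat),
    monomial_rep f u e /\
    t = \big[Order.min/+oo%E]_(i < n) (exponent_val r (e i))%:E].

Definition monomial_valK (r : R) (z : {fraction D}) : \bar R :=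
  xget +oo%E [set t | exists f g : D,
    [/\ g != 0, z = tofrac f / tofrac g &
        t = (monomial_valD r f - monomial_valD r g)%E]].

Definition valuation_ring_r (r : R) : set {fraction D} :=
  [set z | (0 <= monomial_valK r z)%E].

Definition max_ideal_r (r : R) : set {fraction D} :=
  [set z | (0 < monomial_valK r z)%E].

Definition interval_ring (I : set R) : set {fraction D} :=
  \bigcap_(V in [set V : set {fraction D} |
      [/\ valuation_ring V, range (@tofrac D) `<=` V &
          exists2 r, I r & V `<=` valuation_ring_r r]]) V.

End MonomialValuation.

(* Main.v *)
Require Import Defs.
From mathcomp Require Import all_boot all_order all_algebra generic_quotient.
From mathcomp Require Import boolp classical_sets set_interval reals constructive_ereal.
From mathcomp Require Import ring lra zify.

Set Implicit Arguments.
Unset Strict Implicit.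
Unset Printing Implicit Defensive.

Import Order.TTheory GRing.Theory Num.Theory.
Local Open Scope classical_set_scope.
Local Open Scope ring_scope.

(** Write T for the interval ring and M_r for the maximal ideal of V_r.  The
    point is that the condition z \in M_r does not depend on r for z in T.

    Fix z in T and r in [a, b] with z not in M_r.  If z did not belong to the
    ring (D + M_r)[z^-1], some valuation ring W would contain that ring and
    omit z ([valuation_ring_avoiding]).  Such a W contains D and M_r, and it
    lies inside V_r: an element of W outside V_r would have its inverse in M_r,
    so that all of V_r, including z, would be in W.  Hence W is one of the rings
    whose intersection is T, and z is in W after all.  So z is a polynomial in
    z^-1 over D + M_r, that is, its residue in V_r / M_r is a nonzero algebraic
    element over the residue field of D; its inverse is therefore a polynomial
    in it, which gives t in T with z t - 1 in M_r ([inverse_mod_max_ideal]).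

    For a fixed element w of the quotient field, the set of r > 0 with w in M_r
    is open, because v_r of a fixed nonzero element of D is a minimum of finitely
    many affine functions of r ([max_ideal_r_open]).  Applied to w = z and to
    w = z t - 1, this shows that both {r : z in M_r} and its complement in [a, b]
    are open, so one of them is empty ([max_ideal_slope_indep]).  An element z
    of T outside the intersection of the M_r is thus outside every M_r, and
    z^-1 = t (z t)^-1 is in every ring of the intersection defining T, since
    z t is 1 modulo M_r and M_r is contained in that ring
    ([interval_ring_inverse]).

    All this rests on v_r being a valuation.  That x, y form a regular sequence
    follows from the dimension being 2 by the argument for the principal ideal
    theorem ([power_not_dvdx]).  It yields that no unit multiple of x^p y^q is
    in (x^(p+1), y^(q+1)) ([monomial_notin_corner]).  Ordering the
    monomials by v_r, with ties broken by the exponent of y, every nonzero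
    element then has a well-defined leading monomial, and leading monomials
    multiply ([leadsM]). *)

(** * Subrings, ideals and valuation rings of a field *)

(** The common part of the constructions of maximal ideals and of valuation
    rings: subsets of both kinds are closed under a family of binary operations,
    and such closure passes to unions of chains. *)
Lemma maximal_closed_avoiding (T I : Type) (op : I -> T -> T -> T) (A : set T)
    (z : T) (closed := fun B : set T =>
      forall i u v, B u -> B v -> B (op i u v)) :
    closed A -> ~ A z ->
  exists B, [/\ A `<=` B, closed B, ~ B z &
    forall C, B `<=` C -> closed C -> ~ C z -> C `<=` B].
Proof.
move=> clA nAz.
have [|V [[clV Vz] maxV]] := @Zorn_bigcup T
    [set B | closed (A `|` B) /\ ~ (A `|` B) z].
  move=> F FP totF; set U := \bigcup_(X in F) X.
  have AUE u : (A `|` U) u -> A u \/ exists2 X, F X & X u.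
    by case=> [|[X FX Xu]]; [left|right; exists X].
  have inU X : F X -> A `|` X `<=` A `|` U.
    by move=> FX u [|Xu]; [left|right; exists X].
  split=> [i u v /AUE[Au|[X FX Xu]] /AUE[Av|[Y FY Yv]]|].
  - by left; apply: clA.
  - by apply: (inU Y FY); case: (FP _ FY) => clY _; apply: clY; [left|right].
  - by apply: (inU X FX); case: (FP _ FX) => clX _; apply: clX; [right|left].
  - have [XY|YX] := totF _ _ FX FY.
      apply: (inU Y FY); case: (FP _ FY) => clY _.
      by apply: clY; right=> //; apply: XY.
    apply: (inU X FX); case: (FP _ FX) => clX _.
    by apply: clX; right=> //; apply: YX.
  - by move=> /AUE[//|[X FX Xz]]; case: (FP _ FX) => _; apply; right.
exists (A `|` V); split=> [u|//|//|C VC clC nCz u Cu]; first by left.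
apply: contrapT => nVu; apply: (maxV C).
  by split=> [v Vv|CV]; [apply: VC; right|apply: nVu; right; apply: CV].
have AC : A `|` C = C by apply/seteqP; split=> v; [case=> // Av; apply: VC; left|right].
by rewrite /mkset AC.
Qed.

Section Subrings.
Variables (K : comNzRingType).
Implicit Types (A : set K).

Lemma subring_ofP A : subring_of A <->
  [/\ A 1, forall u v, A u -> A v -> A (u - v)
         & forall u v, A u -> A v -> A (u * v)].
Proof.
split=> -[A1 AB AM]; split.
- exact: set_mem.
- by move=> u v Au Av; apply/set_mem/AB; apply/mem_set.
- by move=> u v Au Av; apply/set_mem/AM; apply/mem_set.
- exact/mem_set.
- by move=> u v /set_mem Au /set_mem Av; apply/mem_set/AB.
- by move=> u v /set_mem Au /set_mem Av; apply/mem_set/AM.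
Qed.

Variables (A : set K).
Hypothesis hA : subring_of A.

Lemma subring1 : A 1. Proof. by case/subring_ofP: hA. Qed.

Lemma subringM u v : A u -> A v -> A (u * v).
Proof. by case/subring_ofP: hA => _ _; apply. Qed.

Lemma subringB u v : A u -> A v -> A (u - v).
Proof. by case/subring_ofP: hA => _ + _; apply. Qed.

Lemma subring0 : A 0.
Proof. by rewrite -(subrr 1); apply: subringB subring1 subring1. Qed.

Lemma subringN u : A u -> A (- u).
Proof. by move=> Au; rewrite -sub0r; apply: subringB subring0 Au. Qed.

Lemma subringD u v : A u -> A v -> A (u + v).
Proof. by move=> Au Av; rewrite -[v]opprK; apply/subringB/subringN. Qed.

Lemma subringX u n : A u -> A (u ^+ n).
Proof.
move=> Au; elim: n => [|n IH]; first exact: subring1.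
by rewrite exprS; apply: subringM.
Qed.

Lemma subring_sum n (F : nat -> K) :
  (forall i, (i < n)%N -> A (F i)) -> A (\sum_(i < n) F i).
Proof.
by move=> AF; apply: big_ind => [||i _]; [exact: subring0|exact: subringD|exact/AF].
Qed.

End Subrings.

(** Every proper ideal consists of non-invertible elements, so it lies in M. *)
Lemma local_ring_inverse (K : fieldType) (A M : set K) :
    subring_of A -> ideal_of A M -> ~ M 1 ->
    (forall z, A z -> ~ M z -> A z^-1) ->
  local_ring A M.
Proof.
move=> hA hM M1 AV; case: (hM) => MA M0 MD MM; split=> // N.
have propM J : ideal_of A J -> J <> A -> J `<=` M.
  move=> [JA J0 JD JM] JnA z Jz; apply: contrapT => nMz; apply: JnA.
  have z0 : z != 0 by apply: contra_notN nMz => /eqP->.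
  have J1 : J 1 by rewrite -(mulVf z0); apply: JM (AV _ (JA _ Jz) nMz) Jz.
  by apply/seteqP; split=> // w Aw; rewrite -[w]mulr1; apply: JM.
have MnA : M <> A by move=> MeA; apply: M1; rewrite MeA; apply: subring1.
split=> [[hN NnA maxN]|->].
  by have [//|//] := maxN _ hM (propM _ hN NnA).
split=> // J hJ MJ; have [|JnA] := pselect (J = A); [by right|left].
by apply/seteqP; split=> //; apply: propM.
Qed.

Section Adjunction.
Variables (K : comNzRingType) (A : set K) (t : K).
Hypothesis hA : subring_of A.

(** The degree bound n is recorded because [not_adjoin_both] descends on it. *)
Definition poly_values n : set K :=
  [set z | exists2 c : nat -> K, (forall i, A (c i)) &
    z = \sum_(i < n) c i * t ^+ i].

Definition adjoin : set K := \bigcup_n poly_values n.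

Lemma poly_valuesD n u v :
  poly_values n u -> poly_values n v -> poly_values n (u + v).
Proof.
move=> [c Ac ->] [d Ad ->]; exists (fun i => c i + d i).
  by move=> i; apply: subringD.
by rewrite -big_split; apply: eq_bigr => i _; rewrite mulrDl.
Qed.

Lemma poly_valuesZ n a u : A a -> poly_values n u -> poly_values n (a * u).
Proof.
move=> Aa [c Ac ->]; exists (fun i => a * c i).
  by move=> i; apply: subringM.
by rewrite mulr_sumr; apply: eq_bigr => i _; rewrite mulrA.
Qed.

Lemma poly_values_exp n i : (i < n)%N -> poly_values n (t ^+ i).
Proof.
move=> lt_in; exists (fun j => (j == i)%:R).
  by move=> j; case: eqP => _; [apply: subring1|apply: subring0].
rewrite (bigD1 (Ordinal lt_in)) //= eqxx mul1r big1 ?addr0 // => j ne_ji.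
by rewrite -val_eqE /= in ne_ji; rewrite (negPf ne_ji) mul0r.
Qed.

Lemma poly_values0 n : poly_values n 0.
Proof.
exists (fun=> 0) => [_|]; first exact: subring0.
by rewrite big1 // => i _; rewrite mul0r.
Qed.

Lemma poly_values_sum n k (F : nat -> K) :
  (forall i, (i < k)%N -> poly_values n (F i)) ->
  poly_values n (\sum_(i < k) F i).
Proof.
move=> PF; apply: big_ind => [||i _]; last exact: PF.
  exact: poly_values0.
exact: poly_valuesD.
Qed.

Lemma poly_values_shift n i z :
  poly_values n z -> poly_values (n + i) (t ^+ i * z).
Proof.
move=> [c Ac ->]; rewrite mulr_sumr.
apply: (poly_values_sum (F := fun j => t ^+ i * (c j * t ^+ j))) => j ltjn.
rewrite mulrCA -exprD; apply: poly_valuesZ => //; apply: poly_values_exp.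
by rewrite addnC ltn_add2r.
Qed.

Lemma poly_values_leq n m z : (n <= m)%N -> poly_values n z -> poly_values m z.
Proof.
move=> lenm [c Ac ->].
apply: (poly_values_sum (F := fun j => c j * t ^+ j)) => j ltjn.
by apply: poly_valuesZ => //; apply: poly_values_exp; apply: leq_trans lenm.
Qed.

Lemma poly_valuesM n m u v :
  poly_values n u -> poly_values m v -> poly_values (n + m) (u * v).
Proof.
move=> [c Ac ->] mv; rewrite mulr_suml.
apply: (poly_values_sum (F := fun j => c j * t ^+ j * v)) => j ltjn.
rewrite -mulrA; apply: poly_valuesZ => //.
by apply: poly_values_leq (poly_values_shift j mv); rewrite addnC leq_add2r ltnW.
Qed.

Lemma sub_adjoin : A `<=` adjoin.
Proof.
move=> a Aa; exists 1%N => //; rewrite -[a]mulr1 -(expr0 t).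
by apply/poly_valuesZ/poly_values_exp.
Qed.

Lemma adjoin_gen : adjoin t.
Proof. by exists 2%N => //; rewrite -[X in poly_values _ X]expr1; apply: poly_values_exp. Qed.

Lemma adjoin_subring : subring_of adjoin.
Proof.
apply/subring_ofP; split; first by apply: (sub_adjoin (subring1 hA)).
- move=> u v [n _ nu] [m _ mv]; exists (maxn n m) => //; rewrite -mulN1r.
  apply: poly_valuesD; first exact: poly_values_leq (leq_maxl _ _) nu.
  apply: poly_valuesZ (poly_values_leq (leq_maxr _ _) mv).
  by apply: subringN (subring1 hA).
- by move=> u v [n _ nu] [m _ mv]; exists (n + m)%N => //; apply: poly_valuesM.
Qed.

End Adjunction.

Section ValuationRings.
Variable K : fieldType.
Implicit Types (A V : set K).

(** Descent on degrees: write z as a polynomial in t and as one in t^-1, the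
    former of degree n at least that of the latter.  Multiplying the first by
    1 - z^-1 q_0, where q_0 is the constant coefficient of the second, lets the
    second be used to rewrite the top term through lower powers of t; this needs
    z^-1 in A. *)
Lemma not_adjoin_both A (t z : K) : subring_of A -> A z^-1 -> ~ A z -> t != 0 ->
  adjoin A t z -> adjoin A t^-1 z -> False.
Proof.
move=> hA Aw nAz t0 [n _ nz] [m _ mz].
have z0 : z != 0 by apply: contra_notN nAz => /eqP->; apply: subring0.
elim: {n m}(n + m)%N {-2}n {-2}m (leqnn (n + m)) t t0 nz mz => [|N IH] n m.
  rewrite leqn0 addn_eq0 => /andP[/eqP-> _] t _ [c _]; rewrite big_ord0 => z00.
  by rewrite z00 eqxx in z0.
wlog lemn : n m / (m <= n)%N => [th le_nmN t t0 nz mz|].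
  have [le|/ltnW le] := leqP m n; first exact: (th n m le le_nmN t t0 nz mz).
  apply: (th m n le _ t^-1) => //; rewrite ?invr_eq0 ?invrK //.
  by rewrite addnC.
case: m lemn => [|m] lemn le_nmN t t0 nz.
  by case=> c _; rewrite big_ord0 => z00; rewrite z00 eqxx in z0.
case: n lemn le_nmN nz => [//|n] lemn le_nmN nz mz.
case: n lemn le_nmN nz => [|n] lemn le_nmN nz.
  by case: nz => c Ac; rewrite big_ord1 mulr1 => zc; apply: nAz; rewrite zc.
apply: (IH n.+1 m.+1 _ t t0 _ mz); first by rewrite -ltnS.
case: nz => p Ap zp; case: mz => q Aq zq.
rewrite big_ord_recr /= in zp; rewrite big_ord_recl /= mulr1 in zq.
set P := \sum_(i < _) _ in zp; set Q := \sum_(i < _) _ in zq.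
have nP : poly_values A t n.+1 P by exists p.
have nQ : poly_values A t n.+1 (t ^+ n.+1 * Q).
  rewrite mulr_sumr.
  apply: (@poly_values_sum _ _ _ hA _ _
            (fun i => t ^+ n.+1 * (q i.+1 * t^-1 ^+ i.+1))) => i ltim.
  have -> : t ^+ n.+1 * (q i.+1 * t^-1 ^+ i.+1) = q i.+1 * t ^+ (n - i).
    have -> : n.+1 = (n - i + i.+1)%N by lia.
    by rewrite exprD exprVn; field; apply: expf_neq0.
  by apply: poly_valuesZ => //; apply: poly_values_exp => //; lia.
(* The top term p_(n+1) t^(n+1) is multiplied by 1 - z^-1 q_0 = z^-1 Q. *)
have -> : z = q 0%N + (1 - z^-1 * q 0%N) * P + (z^-1 * p n.+1) * (t ^+ n.+1 * Q).
  have Qz : Q = z - q 0%N by rewrite {1}zq addrC addKr.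
  have Pz : P = z - p n.+1 * t ^+ n.+1 by rewrite {1}zp addrK.
  by rewrite Qz Pz; field.
apply: poly_valuesD => //; last by apply: poly_valuesZ => //; apply: subringM.
apply: poly_valuesD => //.
  by rewrite -[q _]mulr1 -(expr0 t); apply: poly_valuesZ => //; apply: poly_values_exp.
by apply: poly_valuesZ => //; apply: subringB (subring1 hA) _ => //; apply: subringM.
Qed.

(** A subring W maximal among those containing A and omitting z is a valuation
    ring: for t with neither t nor t^-1 in W, both W[t] and W[t^-1] would contain z. *)
Lemma valuation_ring_avoiding A (z : K) : subring_of A -> A z^-1 -> ~ A z ->
  exists V, [/\ valuation_ring V, A `<=` V & ~ V z].
Proof.
move=> hA Aw nAz.
have clE B : A `<=` B ->
    (forall b u v, B u -> B v -> B (if b then u - v else u * v)) ->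
    subring_of B.
  move=> AB clB; apply/subring_ofP; split; first exact/AB/(subring1 hA).
    by move=> u v; apply: (clB true).
  by move=> u v; apply: (clB false).
have [|W [AW /(clE _ AW) hW nWz maxW]] :=
    maximal_closed_avoiding (op := fun b u v => if b then u - v else u * v) _ nAz.
  by case=> u v; [apply: subringB|apply: subringM].
exists W; split=> //; split=> // t t0.
have maxW' s : ~ W s -> adjoin W s z.
  move=> nWs; apply: contrapT => nz; apply: nWs.
  apply: (maxW (adjoin W s)) (adjoin_gen _ hW) => //; first exact: sub_adjoin.
  by case=> u v; [apply: subringB|apply: subringM]; apply: adjoin_subring.
have [|nWt] := pselect (W t); [by left|right; apply: contrapT => nWtV].
by apply: (not_adjoin_both hW (AW _ Aw) nWz t0); apply: maxW'.
Qed.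

End ValuationRings.

(** * Noetherian local domains and the principal ideal theorem *)

Section LocalRings.
Variable D : idomainType.
Implicit Types J M : set D.

(** A nonunit generates a proper ideal, which extends to a maximal one; the
    latter is M by uniqueness. *)
Lemma local_ring_unit M z : local_ring [set: D] M -> ~ M z -> z \is a GRing.unit.
Proof.
move=> [_ maxM]; apply: contra_notT => nuz.
pose op (c : option D) (u v : D) := if c is Some a then a * u else u + v.
have [||B [AB clB nB1 maxB]] :=
    maximal_closed_avoiding (op := op) (A := [set w | exists c, w = c * z]) (z := 1).
- case=> [a|] _ _ [b ->] [c ->]; first by exists (a * b); rewrite /op mulrA.
  by exists (b + c); rewrite /op mulrDl.
- by case=> c c1; move/negP: nuz; apply; apply/unitrPr; exists c; rewrite mulrC -c1.
have Bz : B z by apply: AB; exists 1; rewrite mul1r.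
suff /maxM <- : maximal_ideal_of [set: D] B by [].
split.
- split=> //; first by apply: AB; exists 0; rewrite mul0r.
    by move=> u v; apply: (clB None).
  by move=> c u _ Bu; apply: (clB (Some c) u u).
- by move=> BT; apply: nB1; rewrite BT.
move=> J [_ J0 JD JM] BJ; have [J1|nJ1] := pselect (J 1).
  by right; apply/seteqP; split=> // u _; rewrite -[u]mulr1; apply: JM.
left; apply/seteqP; split=> //; apply: maxB => // -[c|] u v Ju Jv.
  exact: JM.
exact: JD.
Qed.

Lemma local_ring_nunit M z : local_ring [set: D] M -> z \is a GRing.unit -> ~ M z.
Proof.
move=> [_ maxM] uz Mz; have [[_ _ _ MM] MnT _] := (maxM M).2 erefl.
apply: MnT; apply/seteqP; split=> // w _.
by rewrite -[w](mulrK uz) mulrAC; apply: MM.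
Qed.

Hypothesis noethD : noetherian D.

Lemma noetherian_acc (U : nat -> set D) :
    (forall n, ideal_of [set: D] (U n)) -> (forall n, U n `<=` U n.+1) ->
  exists N, U N.+1 `<=` U N.
Proof.
move=> idU leU.
have monU n k : U n `<=` U (n + k)%N.
  elim: k => [|k IH]; first by rewrite addn0.
  by rewrite addnS; apply: subset_trans IH (leU _).
have monU' n k : (n <= k)%N -> U n `<=` U k by move=> /subnKC <-; apply: monU.
have [|s Us] := noethD (J := \bigcup_n U n).
  split=> //.
  - by exists 0%N => //; case: (idU 0%N).
  - move=> u v [n _ nu] [k _ kv]; exists (maxn n k) => //.
    case: (idU (maxn n k)) => _ _ UD _; apply: UD.
      exact: monU' (leq_maxl _ _) _ nu.
    exact: monU' (leq_maxr _ _) _ kv.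
  - by move=> c u _ [n _ nu]; exists n => //; case: (idU n) => _ _ _; apply.
have sU i : (i < size s)%N -> exists n, U n s`_i.
  move=> lt_is; suff: (\bigcup_n U n) s`_i by case=> n _; exists n.
  rewrite Us; exists (fun j => (j == i :> nat)%:R).
  rewrite (bigD1 (Ordinal lt_is)) //= eqxx mul1r big1 ?addr0 // => j ne_ji.
  by rewrite -val_eqE /= in ne_ji; rewrite (negPf ne_ji) mul0r.
have [N sN] : exists N, forall i, (i < size s)%N -> U N s`_i.
  elim: (s) sU => [|a l IH] aU; first by exists 0%N.
  have [n na] := aU 0%N isT; have [i ltil|k kl] := IH; first exact: (aU i.+1).
  exists (maxn n k) => -[|i] lti; first exact: monU' (leq_maxl _ _) _ na.
  exact: monU' (leq_maxr _ _) _ (kl i lti).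
exists N => z Uz; case: (idU N) => _ U0 UD UM.
have [c ->] : ideal_gen s z by rewrite -Us; exists N.+1.
by apply: big_ind => // i _; apply: UM => //; apply: sN.
Qed.

(** The ideals (J + z D : v^n) increase with n, so two consecutive ones agree at
    some N.  Writing z = v^(N+1) w modulo J, the element w is in the (N+1)-st
    ideal, hence in the N-th: v^N w = z c modulo J, so that (1 - v c) z is in J. *)
Lemma krull_intersection J v z :
    ideal_of [set: D] J -> (forall c, 1 - v * c \is a GRing.unit) ->
  (forall n, exists c, J (z - v ^+ n * c)) -> J z.
Proof.
move=> [_ J0 JD JM] uv zJ.
pose U n : set D := [set w | exists c, J (v ^+ n * w - z * c)].
have [n|n w [c Jc]|N UN] := @noetherian_acc U.
- split=> //; first by exists 0; rewrite !mulr0 subr0.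
    move=> a b [c Jc] [d Jd]; exists (c + d).
    have -> : v ^+ n * (a + b) - z * (c + d) =
      (v ^+ n * a - z * c) + (v ^+ n * b - z * d) by ring.
    exact: JD.
  move=> a b _ [c Jc]; exists (a * c).
  have -> : v ^+ n * (a * b) - z * (a * c) = a * (v ^+ n * b - z * c) by ring.
  exact: JM.
- exists (v * c).
  have -> : v ^+ n.+1 * w - z * (v * c) = v * (v ^+ n * w - z * c) by rewrite exprS; ring.
  exact: JM.
have [w Jw] := zJ N.+1.
have [|c Jc] := UN w.
  exists 1; have -> : v ^+ N.+1 * w - z * 1 = -1 * (z - v ^+ N.+1 * w) by ring.
  exact: JM.
have -> : z = (1 - v * c)^-1 * ((z - v ^+ N.+1 * w) + v * (v ^+ N * w - z * c)).
  have -> : z - v ^+ N.+1 * w + v * (v ^+ N * w - z * c) = (1 - v * c) * z.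
    by rewrite exprS; ring.
  by rewrite mulKr.
by apply: (JM) => //; apply: JD => //; apply: JM.
Qed.

Lemma maximal_power_mod J v f :
    ideal_of [set: D] J -> (forall c, 1 - v * c \is a GRing.unit) -> ~ J f ->
  exists i g, J (f - v ^+ i * g) /\ ~ exists c, J (g - v * c).
Proof.
move=> hJ uv; apply: contra_notP => nex; apply: (krull_intersection hJ uv).
case: hJ => _ J0 JD JM.
elim=> [|i [g Jg]]; first by exists f; rewrite mul1r subrr.
have [c Jc] : exists c, J (g - v * c).
  by apply: contrapT => nc; apply: nex; exists i, g.
exists c; have -> : f - v ^+ i.+1 * c = (f - v ^+ i * g) + v ^+ i * (g - v * c).
  by rewrite exprS; ring.
by apply: JD => //; apply: JM.
Qed.

Lemma principal_ideal v : ideal_of [set: D] [set z | exists c, z = v * c].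
Proof.
split=> //; first by exists 0; rewrite mulr0.
  by move=> _ _ [a ->] [b ->]; exists (a + b); rewrite mulrDr.
by move=> a _ _ [b ->]; exists (a * b); rewrite mulrCA.
Qed.

End LocalRings.

Section RegularParameters.
Variable D : idomainType.

Lemma ideal_gen2 (x y : D) :
  ideal_gen [:: x; y] = [set z | exists a b, z = a * x + b * y].
Proof.
apply/seteqP; split=> z.
  by case=> c ->; rewrite !big_ord_recl big_ord0 addr0; do 2!eexists.
case=> a [b ->]; exists (fun i => if i == ord0 then a else b).
by rewrite !big_ord_recl big_ord0 addr0.
Qed.

Lemma regular_system_sym (x y : D) :
  regular_system_of_parameters [:: x; y] ->
  regular_system_of_parameters [:: y; x].
Proof.
have -> : regular_system_of_parameters [:: y; x] =
          regular_system_of_parameters [:: x; y].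
  rewrite /regular_system_of_parameters /=; congr [/\ _, local_ring _ _ & _].
  by rewrite !ideal_gen2; apply/seteqP; split=> z [a [b ->]]; exists b, a; rewrite addrC.
by [].
Qed.

Lemma prime_idealP (P : set D) : prime_ideal P ->
  [/\ ideal_of [set: D] P, ~ P 1 & forall u v, P (u * v) -> P u \/ P v].
Proof.
case=> -[P0 P1 PD] PM; have {}PD a u v : P u -> P v -> P (a * u + v).
  by move=> Pu Pv; apply/set_mem/PD; apply/mem_set.
split; [split=> //| |].
- exact: set_mem.
- by move=> u v Pu Pv; rewrite -[u]mul1r; apply: PD.
- by move=> c u _ Pu; rewrite -[_ * _]addr0; apply: PD => //; apply: set_mem.
- by move=> /mem_set Q1; rewrite Q1 in P1.
- by move=> u v /mem_set /PM /orP[] /set_mem; [left|right].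
Qed.

Variables x y : D.
Hypothesis hD : regular_system_of_parameters [:: x; y].

Let noethD : noetherian D. Proof. by case: hD. Qed.

Lemma nonunit_in_max z : z \isn't a GRing.unit -> exists a b, z = a * x + b * y.
Proof.
move=> nuz; apply: contrapT => nmz; move/negP: nuz; apply.
case: hD => _ hL _; apply: local_ring_unit hL _.
by rewrite ideal_gen2.
Qed.

Lemma max_nonunit a b : a * x + b * y \isn't a GRing.unit.
Proof.
apply/negP => uz; case: hD => _ hL _; apply: local_ring_nunit hL uz _.
by rewrite ideal_gen2; exists a, b.
Qed.

Lemma unit_sub_max u a b :
  u \is a GRing.unit -> u - (a * x + b * y) \is a GRing.unit.
Proof.
move=> uu; apply: contraT => /nonunit_in_max [c [d]] /eqP.
rewrite subr_eq => /eqP ucd; move: uu; rewrite ucd.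
have -> : c * x + d * y + (a * x + b * y) = (c + a) * x + (d + b) * y by ring.
by move=> uu; move: (max_nonunit (c + a) (d + b)); rewrite uu.
Qed.

Lemma unit1Bx c : 1 - x * c \is a GRing.unit.
Proof. by have := unit_sub_max c 0 (unitr1 D); rewrite mul0r addr0 mulrC. Qed.

Lemma unit1By c : 1 - y * c \is a GRing.unit.
Proof. by have := unit_sub_max 0 c (unitr1 D); rewrite mul0r add0r mulrC. Qed.

Lemma unit_power_mod_x f : (~ exists c, f = x * c) ->
  exists i u c, u \is a GRing.unit /\ f = u * y ^+ i + x * c.
Proof.
move=> nxf.
have [i [u [[c fc] nu]]] :=
  maximal_power_mod noethD (principal_ideal x) unit1By nxf.
exists i, u, c; split; last by rewrite -fc; ring.
apply: contraT => /nonunit_in_max [a [b uab]]; case: nu; exists b, a.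
by rewrite uab; ring.
Qed.

(** If x divided y^n, a prime Q strictly between 0 and the maximal ideal would
    omit x.  Take a nonzero in Q and let J_k be the ideal of the z with s z in
    a^k D for some s outside Q.  Modulo x the maximal ideal is generated by the
    nilpotent y, so every ideal is generated by a power of y and the decreasing
    sequence J_k + x D is stationary somewhere, say at k.  As x is outside Q,
    this means J_k = J_(k+1) + x J_k, whence J_k = J_(k+1) by Krull's intersection
    theorem.  But then a^k is in J_(k+1), that is, some s outside Q is a multiple
    of a, which is in Q. *)
Lemma power_not_dvdx n : ~ exists c, y ^+ n = x * c.
Proof.
move=> [c0 ync].
have [Q [hQ nQ1 Qpr] [nQxy [a Qa a0]]] : exists2 Q : set D,
    [/\ ideal_of [set: D] Q, ~ Q 1 & forall u v, Q (u * v) -> Q u \/ Q v] &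
    ~ (Q x /\ Q y) /\ exists2 a, Q a & a != 0.
  case: hD => _ _ [[P [prP ltP]] _] /=.
  pose i1 : 'I_3 := @Ordinal 3 1 isT; pose i2 : 'I_3 := @Ordinal 3 2 isT.
  exists (P i1); first exact: prime_idealP.
  split.
    move=> [P1x P1y]; have [_] := ltP i1 i2 isT; apply=> z P2z.
    have [[_ _ _ P2M] nP21 _] := prime_idealP (prP i2).
    have [[_ _ P1D P1M] _ _] := prime_idealP (prP i1).
    have [|u [v ->]] := nonunit_in_max (z := z).
      apply/negP => uz; apply: nP21; rewrite -(mulVr uz); exact: P2M.
    by apply: P1D; apply: P1M.
  have [_ nP10] := ltP ord0 i1 isT.
  apply: contrapT => no; apply: nP10 => z P1z.
  have [[_ P00 _ _] _ _] := prime_idealP (prP ord0).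
  have [->//|z0] := eqVneq z 0.
  by case: no; exists z.
case: hQ => _ Q0 QD QM.
have nQx : ~ Q x.
  move=> Qx; apply: nQxy; split=> //.
  have : Q (y ^+ n) by rewrite ync mulrC; apply: QM.
  by elim: n {ync} => [|n IH]; [move=> /nQ1|rewrite exprS => /Qpr[|/IH]].
pose J k : set D := [set z | exists s, ~ Q s /\ exists c, s * z = a ^+ k * c].
have idJ k : ideal_of [set: D] (J k).
  split=> //.
  - by exists 1; split=> //; exists 0; rewrite !mulr0.
  - move=> u v [s [nQs [c sc]]] [t [nQt [d td]]]; exists (s * t).
    split; first by move=> /Qpr[].
    exists (t * c + s * d).
    have -> : s * t * (u + v) = t * (s * u) + s * (t * v) by ring.
    by rewrite sc td; ring.
  - move=> b u _ [s [nQs [c sc]]]; exists s; split=> //; exists (b * c).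
    by rewrite mulrCA sc; ring.
have leJ k : J k.+1 `<=` J k.
  move=> z [s [nQs [c sc]]]; exists s; split=> //; exists (a * c).
  by rewrite sc exprS; ring.
have xJ k z : J k (x * z) -> J k z.
  move=> [s [nQs [c sc]]]; exists (s * x); split; first by move=> /Qpr[].
  by exists c; rewrite -mulrA.
(* E k i says that y^i is in J_k + x D; its least i grows with k up to n. *)
pose E k i := exists c, J k (y ^+ i - x * c).
have [k Ek] : exists k, forall i, E k i -> E k.+1 i.
  apply: contrapT => no.
  have Emon k i j : (i <= j)%N -> E k i -> E k j.
    move=> /subnK <- [c Jc]; exists (y ^+ (j - i) * c); rewrite exprD.
    have -> : y ^+ (j - i) * y ^+ i - x * (y ^+ (j - i) * c) =
      y ^+ (j - i) * (y ^+ i - x * c) by ring.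
    by case: (idJ k) => _ _ _; apply.
  have nE k i : (i < k)%N -> ~ E k i.
    elim: k i => // k IH i; rewrite ltnS => leik Ei; apply: no; exists k => j Ej.
    apply: (Emon _ i) => //; apply: leq_trans leik _.
    by rewrite leqNgt; apply/negP => /IH.
  apply: (nE n.+1 n) => //; exists c0; rewrite ync subrr.
  by case: (idJ n.+1).
case: (idJ k) (idJ k.+1) => _ Jk0 JkD JkM [_ J0 JD JM].
have Jstep z : J k z -> exists2 c, J k c & J k.+1 (z - x * c).
  move=> Jz; suff [c Jc] : exists c, J k.+1 (z - x * c).
    exists c => //; apply: xJ.
    have -> : x * c = z + (-1) * (z - x * c) by ring.
    by apply: JkD => //; apply/JkM/leJ.
  have [[c ->]|nxz] := pselect (exists c, z = x * c); first by exists c; rewrite subrr.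
  have [i [u [c [uu zE]]]] := unit_power_mod_x nxz.
  have [|d Jd] := Ek i.
    exists (- u^-1 * c); have -> : y ^+ i - x * (- u^-1 * c) = u^-1 * z.
      by rewrite zE mulrDr mulKr //; ring.
    exact: JkM.
  exists (c + u * d); have -> : z - x * (c + u * d) = u * (y ^+ i - x * d).
    by rewrite zE; ring.
  exact: JM.
have {}Jstep N z : J k z -> exists2 c, J k c & J k.+1 (z - x ^+ N * c).
  move=> Jz; elim: N => [|N [c Jc zc]]; first by exists z; rewrite ?mul1r ?subrr.
  have [d Jd cd] := Jstep c Jc; exists d => //.
  have -> : z - x ^+ N.+1 * d = z - x ^+ N * c + x ^+ N * (c - x * d).
    by rewrite exprS; ring.
  by apply: JD => //; apply: JM.
have [s [nQs [c]]] : J k.+1 (a ^+ k).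
  apply: (krull_intersection noethD (idJ k.+1) unit1Bx) => N.
  have [|c _] := Jstep N (a ^+ k); last by exists c.
  by exists 1; split=> //; exists 1; rewrite mulrC.
rewrite mulrC exprSr -mulrA => /(mulfI (expf_neq0 k a0)) sac.
by apply: nQs; rewrite sac mulrC; apply: QM.
Qed.

End RegularParameters.

(** * Monomial representations *)

Section Representations.
Variables (D : idomainType) (x y : D).
Hypothesis hD : regular_system_of_parameters [:: x; y].

Let noethD : noetherian D. Proof. by case: hD. Qed.

Lemma param_neq0 : x != 0.
Proof.
apply/eqP => x0.
by case: (@power_not_dvdx _ y x (regular_system_sym hD) 1); exists 0; rewrite x0 mulr0.
Qed.

Lemma dvdx_power_mul n g : (exists c, y ^+ n * g = x * c) -> exists c, g = x * c.
Proof.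
move=> [c yg]; apply: contrapT => /(unit_power_mod_x hD) [i [u [d [uu gE]]]].
apply: (power_not_dvdx hD (n := n + i)); exists (u^-1 * (c - y ^+ n * d)).
have -> : x * (u^-1 * (c - y ^+ n * d)) = u^-1 * (x * c - x * (y ^+ n * d)) by ring.
rewrite -yg gE exprD.
have -> : y ^+ n * (u * y ^+ i + x * d) - x * (y ^+ n * d) = u * (y ^+ n * y ^+ i).
  by ring.
by rewrite mulKr.
Qed.

(** If x^p y^q is a combination of x^(p+1) and y^(q+1), then x divides the
    coefficient of y^(q+1), because no power of y can supply the factor x; cancelling
    x repeatedly reduces to p = 0, where x would divide y^q. *)
Lemma monomial_notin_corner u p q a b : u \is a GRing.unit ->
  u * monomial x y (p, q) != a * x ^+ p.+1 + b * y ^+ q.+1.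
Proof.
rewrite /monomial /= => uu; apply/eqP; elim: p a b => [|p IH] a b E.
  have yu : y ^+ q * (u - b * y) = x * a.
    rewrite mulrBr.
    have -> : y ^+ q * u - y ^+ q * (b * y) = u * (x ^+ 0 * y ^+ q) - b * y ^+ q.+1.
      by rewrite exprS; ring.
    by rewrite E; ring.
  have ub : u - b * y \is a GRing.unit.
    by have := unit_sub_max hD 0 b uu; rewrite mul0r add0r.
  apply: (power_not_dvdx hD (n := q)); exists (a * (u - b * y)^-1).
  by rewrite mulrA -yu mulrK.
have [|c bE] := @dvdx_power_mul q.+1 b.
  exists (u * (x ^+ p * y ^+ q) - a * x ^+ p.+1).
  have -> : x * (u * (x ^+ p * y ^+ q) - a * x ^+ p.+1) =
      u * (x ^+ p.+1 * y ^+ q) - a * x ^+ p.+2 by rewrite !exprS; ring.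
  by rewrite E; ring.
apply: (IH a c); apply: (mulfI param_neq0).
have -> : x * (u * (x ^+ p * y ^+ q)) = u * (x ^+ p.+1 * y ^+ q).
  by rewrite exprS; ring.
by rewrite E bE [x ^+ p.+2]exprS; ring.
Qed.

Lemma divides_monomial e e' : divides (monomial x y e) (monomial x y e') ->
  (e.1 <= e'.1)%N && (e.2 <= e'.2)%N.
Proof.
case: e e' => [p q] [p' q'] [c]; rewrite /monomial /= => E.
have := monomial_notin_corner p' q' _ _ (unitr1 D); rewrite /monomial /= mul1r => nE.
apply/andP; split; rewrite leqNgt; apply/negP => lt.
  have := nE (c * x ^+ (p - p'.+1) * y ^+ q) 0; rewrite E => /eqP; apply.
  by rewrite -{1}(subnK lt) exprD; ring.
have := nE 0 (c * y ^+ (q - q'.+1) * x ^+ p); rewrite E => /eqP; apply.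
by rewrite -{1}(subnK lt) exprD; ring.
Qed.

Implicit Types (s : seq (D * (nat * nat))).

Definition term (t : D * (nat * nat)) : D := t.1 * monomial x y t.2.

(** An antichain for divisibility, sorted by the exponent of x, so that a first
    term can be added by comparing exponents of y only. *)
Definition staircase s : bool :=
  all (fun t => t.1 \is a GRing.unit) s &&
  pairwise (fun t t' => (t.2.1 < t'.2.1)%N && (t'.2.2 < t.2.2)%N) s.

Lemma staircase_rep s : staircase s ->
  exists n (u : 'I_n -> D) e, monomial_rep x y (\sum_(t <- s) term t) u e.
Proof.
move=> /andP[us ps]; pose t0 : D * (nat * nat) := (0, (0%N, 0%N)).
exists (size s), (fun i => (nth t0 s i).1), (fun i => (nth t0 s i).2).
have ndiv (i j : 'I_(size s)) : i != j ->
    ~ divides (monomial x y (nth t0 s i).2) (monomial x y (nth t0 s j).2).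
  move=> neij /divides_monomial /andP[le1 le2].
  have /(pairwiseP t0) pw := ps.
  case: (ltngtP i j) => ij.
  - have /andP[_] := pw i j (ltn_ord i) (ltn_ord j) ij.
    by rewrite ltnNge le2.
  - have /andP[+ _] := pw j i (ltn_ord j) (ltn_ord i) ij.
    by rewrite ltnNge le1.
  - by move/val_inj: ij => ij; rewrite ij eqxx in neij.
split=> //.
- by rewrite (big_nth t0) big_mkord.
- by move=> i; move/(all_nthP t0): us; apply.
- move=> i j E; apply: contrapT => /eqP neij; case: (ndiv i j neij).
  by exists 1; rewrite mul1r E.
Qed.

Definition shift_term p (t : D * (nat * nat)) : D * (nat * nat) :=
  (t.1, (p + t.2.1, t.2.2)%N).

Lemma staircase_cons u p q s : u \is a GRing.unit -> staircase s ->
  all (fun t => (t.2.2 < q)%N) s ->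
  staircase ((u, (p, q)) :: map (shift_term p.+1) s).
Proof.
move=> uu /andP[us ps] qs; rewrite /staircase /= uu /= all_map us /=.
rewrite pairwise_map; apply/andP; split.
  rewrite all_map; apply: sub_all qs => t /= ltq.
  by rewrite ltq addSn ltnS leq_addr.
by apply: sub_pairwise ps => t t' /=; rewrite ltn_add2l.
Qed.

Lemma shift_term_sum p s :
  \sum_(t <- map (shift_term p) s) term t = x ^+ p * \sum_(t <- s) term t.
Proof.
rewrite big_map mulr_sumr; apply: eq_bigr => t _.
by rewrite /term /monomial /= exprD; ring.
Qed.

(** Terms of g of y-degree at least q are absorbed in the coefficient of y^q,
    which remains a unit because they come with a factor x. *)
Lemma staircase_step p q u g s c f d :
    u \is a GRing.unit -> staircase s -> all (fun t => (t.2.2 < q)%N) s ->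
    g = \sum_(t <- s) term t + c * y ^+ q ->
    f = x ^+ p * (u * y ^+ q + x * g) + d ->
  exists2 s', staircase s' /\ all (fun t => (t.2.2 <= q)%N) s' &
    f = \sum_(t <- s') term t + d.
Proof.
move=> uu sts sq gE fE.
exists ((u + x * c, (p, q)) :: map (shift_term p.+1) s).
  split=> //.
    apply: staircase_cons => //.
    have := unit_sub_max hD (- c) 0 uu; rewrite mul0r addr0.
    by congr (_ \is a GRing.unit); ring.
  rewrite /= leqnn all_map; apply: sub_all sq => t /=; exact: ltnW.
rewrite big_cons shift_term_sum fE gE /term /monomial /= exprS; ring.
Qed.

(** Induction on q: for the largest p with g in (x^p, y^q), the cofactor of x^p is
    a unit times y^i plus a multiple of x, for some i < q; only the part of that
    multiple modulo y^i matters, and it is given by the induction hypothesis. *)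
Lemma staircase_mod_power q g : exists s c,
  [/\ staircase s, all (fun t => (t.2.2 < q)%N) s &
      g = \sum_(t <- s) term t + c * y ^+ q].
Proof.
elim/ltn_ind: q g => q IH g.
have [[c gE]|nyg] := pselect (exists c, g = y ^+ q * c).
  by exists [::], c; split=> //; rewrite big_nil add0r gE mulrC.
have [p [f [[d gf] nf]]] :=
  maximal_power_mod noethD (principal_ideal (y ^+ q)) (unit1Bx hD) nyg.
have [|i [u [g' [uu fE]]]] := unit_power_mod_x hD (f := f).
  by move=> [c fc]; apply: nf; exists c; exists 0; rewrite fc mulr0 subrr.
have ltiq : (i < q)%N.
  rewrite ltnNge; apply/negP => leqi; apply: nf; exists g'.
  exists (u * y ^+ (i - q)); rewrite fE addrK -{1}(subnK leqi) exprD; ring.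
have [s [c [sts sq g'E]]] := IH i ltiq g'.
have [|s' [sts' sq'] gE] := staircase_step (p := p) (d := d * y ^+ q) uu sts sq g'E (f := g).
  by rewrite -fE -[LHS](subrK (x ^+ p * f)) gf; ring.
by exists s', d; split=> //; apply: sub_all sq' => t /leq_ltn_trans; apply.
Qed.

(** The step of [staircase_mod_power] with the ideal 0 in place of (y^q). *)
Lemma monomial_rep_exists f : f != 0 ->
  exists n (u : 'I_n -> D) e, monomial_rep x y f u e.
Proof.
move=> f0.
have id0 : ideal_of [set: D] [set 0 : D].
  by split=> // [u v -> ->|c u _ ->]; rewrite /= ?addr0 ?mulr0.
have [|p [g [/eqP fg ng]]] := maximal_power_mod noethD id0 (unit1Bx hD) (f := f).
  exact/eqP.
have [|i [u [g' [uu gE]]]] := unit_power_mod_x hD (f := g).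
  by move=> [c gc]; apply: ng; exists c; rewrite gc subrr.
have [s [c [sts sq g'E]]] := staircase_mod_power i g'.
have [|s' [sts' _]] := staircase_step (p := p) (d := 0) uu sts sq g'E (f := f).
  by rewrite -gE addr0; apply/eqP; rewrite -subr_eq0.
by rewrite addr0 => ->; apply: staircase_rep.
Qed.

End Representations.

(** * Leading monomials and the valuation on D *)

Section ExponentOrder.
Variables (R : realType) (r : R).
Hypothesis r_gt0 : 0 < r.

(** The exponent of y breaks the ties of the weight p + q r, which exist when r
    is rational; the order is then total on all monomials. *)
Definition exponent_key (e : nat * nat) : (R *l nat)%type :=
  (exponent_val r e, e.2).

Definition precedes e e' : bool := (exponent_key e < exponent_key e')%O.

Lemma precedesE e e' : precedes e e' =
  (exponent_val r e < exponent_val r e') ||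
  (exponent_val r e == exponent_val r e') && (e.2 < e'.2)%N.
Proof.
rewrite /precedes /exponent_key Order.ProdLexiOrder.ltEprodlexi /=.
by rewrite ltEnat; case: ltgtP.
Qed.

Lemma exponent_val_precedes e e' :
  precedes e e' -> exponent_val r e <= exponent_val r e'.
Proof. by rewrite precedesE => /orP[/ltW|/andP[/eqP-> _]]. Qed.

Lemma exponent_key_inj : injective exponent_key.
Proof.
move=> [p q] [p' q'] [] /[swap] <-; rewrite /exponent_val /= => /addIr /eqP.
by rewrite eqr_nat => /eqP ->.
Qed.

Definition add_exponents (e d : nat * nat) : nat * nat := (e.1 + d.1, e.2 + d.2)%N.

Lemma exponent_valD e d :
  exponent_val r (add_exponents e d) = exponent_val r e + exponent_val r d.
Proof. by rewrite /exponent_val /= !natrD; ring. Qed.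

Lemma precedes_add e e' d :
  precedes (add_exponents e d) (add_exponents e' d) = precedes e e'.
Proof.
by rewrite !precedesE !exponent_valD ltrD2r (inj_eq (addIr _)) /= ltn_add2r.
Qed.

Lemma precedes_trans e2 e1 e3 : precedes e1 e2 -> precedes e2 e3 -> precedes e1 e3.
Proof. exact: lt_trans. Qed.

Lemma precedes_corner e e' : precedes e e' -> (e.1 < e'.1)%N || (e.2 < e'.2)%N.
Proof.
apply: contraTT; rewrite negb_or -!leqNgt => /andP[le1 le2].
rewrite precedesE negb_or -leNgt negb_and -leqNgt le2 orbT andbT.
by rewrite /exponent_val lerD ?ler_nat // ler_wpM2r ?ler_nat // ltW.
Qed.

End ExponentOrder.

Section LeadingExponents.
Variables (R : realType) (D : idomainType) (x y : D).
Hypothesis hD : regular_system_of_parameters [:: x; y].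

Lemma monomialD e d :
  monomial x y (add_exponents e d) = monomial x y e * monomial x y d.
Proof. by rewrite /monomial /= !exprD; ring. Qed.

(** Membership in the ideal generated by the monomials that strictly follow e. *)
Inductive above (r : R) (e : nat * nat) : D -> Prop :=
| above0 : above r e 0
| aboveD c e' f : precedes r e e' -> above r e f ->
    above r e (c * monomial x y e' + f).

(** The monomial of exponent e is the initial form of f. *)
Definition leads (r : R) (f : D) (e : nat * nat) : Prop :=
  exists2 u, u \is a GRing.unit & above r e (f - u * monomial x y e).

Variable r : R.

Lemma above_add e f g : above r e f -> above r e g -> above r e (f + g).
Proof.
move=> af ag; elim: af => [|c e' h lt_ee' _ IH]; first by rewrite add0r.
by rewrite -addrA; apply: aboveD.
Qed.

Lemma above_mul e a f : above r e f -> above r e (a * f).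
Proof.
elim=> [|c e' h lt_ee' _ IH]; first by rewrite mulr0; apply: above0.
by rewrite mulrDr mulrA; apply: aboveD.
Qed.

Lemma above_monomial e e' c : precedes r e e' -> above r e (c * monomial x y e').
Proof. by move=> lt_ee'; rewrite -[_ * _]addr0; apply/aboveD/above0. Qed.

Lemma above_shift e d f :
  above r e f -> above r (add_exponents e d) (f * monomial x y d).
Proof.
elim=> [|c e' h lt_ee' _ IH]; first by rewrite mul0r; apply: above0.
by rewrite mulrDl -mulrA -monomialD; apply: aboveD; rewrite ?precedes_add.
Qed.

Lemma above_weaken e e' f : precedes r e e' -> above r e' f -> above r e f.
Proof.
move=> lt_ee'; elim=> [|c e2 h lt_e'2 _ IH]; first exact: above0.
by apply: aboveD => //; apply: precedes_trans lt_e'2.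
Qed.

Lemma aboveM e e' f g :
  above r e f -> above r e' g -> above r (add_exponents e e') (f * g).
Proof.
move=> af ag; elim: af => [|c d h lt_ed _ IH]; first by rewrite mul0r; apply: above0.
rewrite mulrDl; apply: above_add => //; rewrite -mulrA [_ * g]mulrC.
apply/above_mul/(above_weaken _ (above_shift d ag)).
by rewrite -(precedes_add r _ _ e') /add_exponents ![(e'.1 + _)%N]addnC
  ![(e'.2 + _)%N]addnC in lt_ed *.
Qed.

Lemma leads_above e e' f : precedes r e' e -> leads r f e -> above r e' f.
Proof.
move=> lt_e'e [u _ fu]; rewrite -[f](subrK (u * monomial x y e)).
by apply: above_add; [apply: above_weaken fu|apply: above_monomial].
Qed.

Hypothesis r_gt0 : 0 < r.

(** A monomial that follows x^p y^q does not divide it, so it is a multiple of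
    x^(p+1) or of y^(q+1). *)
Lemma above_corner e f : above r e f ->
  exists a b, f = a * x ^+ e.1.+1 + b * y ^+ e.2.+1.
Proof.
elim=> [|c [p q] h lt_ee' _ [a [b ->]]]; first by exists 0, 0; rewrite !mul0r addr0.
case/orP: (precedes_corner r_gt0 lt_ee') => /= lt.
  exists (a + c * x ^+ (p - e.1.+1) * y ^+ q), b.
  by rewrite /monomial /= -[X in x ^+ X * _](subnK lt) exprD; ring.
exists a, (b + c * x ^+ p * y ^+ (q - e.2.+1)).
by rewrite /monomial /= -[X in _ * y ^+ X](subnK lt) exprD; ring.
Qed.

Lemma leads_not_above e f : leads r f e -> ~ above r e f.
Proof.
move=> [u uu fu] af; have := above_add af (above_mul (-1) fu).
have -> : f + -1 * (f - u * monomial x y e) = u * monomial x y e by ring.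
case/above_corner => a [b /eqP]; apply/negP.
by rewrite [e]surjective_pairing; apply: monomial_notin_corner.
Qed.

Lemma leads_le e e' f : leads r f e -> leads r f e' -> ~~ precedes r e' e.
Proof.
move=> fe fe'; apply/negP => lt; apply: (leads_not_above fe').
exact: leads_above lt fe.
Qed.

Lemma leads_uniq e e' f : leads r f e -> leads r f e' -> e = e'.
Proof.
move=> fe fe'; apply: (@exponent_key_inj _ r); apply: le_anti.
by rewrite !leNgt (leads_le fe fe') (leads_le fe' fe).
Qed.

Lemma leads_neq0 e f : leads r f e -> f != 0.
Proof.
move=> /leads_not_above naf; apply: contra_notN naf => /eqP ->; exact: above0.
Qed.

Lemma leadsM e e' f f' :
  leads r f e -> leads r f' e' -> leads r (f * f') (add_exponents e e').
Proof.
move=> [u uu fu] [u' uu' fu']; exists (u * u'); first by rewrite unitrM uu uu'.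
set a := f - _ in fu; set a' := f' - _ in fu'.
have -> : f * f' - u * u' * monomial x y (add_exponents e e') =
    u' * (a * monomial x y e') + (u * (a' * monomial x y e) + a * a').
  by rewrite monomialD /a /a'; ring.
have addC : add_exponents e e' = add_exponents e' e.
  by rewrite /add_exponents addnC [X in (_, X)]addnC.
apply: above_add; first exact/above_mul/above_shift.
by apply: above_add; [rewrite addC; apply/above_mul/above_shift|apply: aboveM].
Qed.

Lemma leads_unit u : u \is a GRing.unit -> leads r u (0%N, 0%N).
Proof. by exists u => //; rewrite /monomial !mulr1 subrr; apply: above0. Qed.

(** The least exponent of a representation leads; in particular the minimum in
    the definition of v_r is the weight of the leading monomial, whatever the
    representation. *)
Lemma leads_rep f n (u : 'I_n -> D) (e : 'I_n -> nat * nat) :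
    f != 0 -> monomial_rep x y f u e ->
  exists i, leads r f (e i) /\
    forall j, exponent_val r (e i) <= exponent_val r (e j).
Proof.
move=> f0 [fE uu inj_e _].
have [i0 _] : exists i : 'I_n, true.
  case: n u e fE {uu inj_e} => [|n] u e fE; last by exists ord0.
  by rewrite fE big_ord0 eqxx in f0.
have [i _ mini] := @Order.TotalTheory.arg_minP _ _ _ i0 predT (fun i => exponent_key r (e i)) isT.
have lt_i j : j != i -> precedes r (e i) (e j).
  move=> neji; rewrite /precedes lt_neqAle mini // andbT.
  apply: contraNneq neji => /exponent_key_inj eij; apply/eqP/inj_e.
  by rewrite eij.
exists i; split=> [|j]; last first.
  have [->//|/lt_i] := eqVneq j i; exact: exponent_val_precedes.
exists (u i) => //; rewrite fE (bigD1 i) //= addrAC subrr add0r.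
apply: big_ind => [||j /lt_i ltij]; first exact: above0.
  exact: above_add.
exact: above_monomial.
Qed.

Lemma leads_exists f : f != 0 -> exists e, leads r f e.
Proof.
move=> f0; have [n [u [e rep]]] := monomial_rep_exists hD f0.
by have [i [fe _]] := leads_rep f0 rep; exists (e i).
Qed.

Lemma monomial_valD_leads f e : leads r f e ->
  monomial_valD x y r f = (exponent_val r e)%:E.
Proof.
move=> fe; have f0 := leads_neq0 fe; rewrite /monomial_valD (negPf f0).
have val_rep n (u : 'I_n -> D) (d : 'I_n -> nat * nat) :
    monomial_rep x y f u d ->
    \big[Order.min/+oo%E]_(i < n) (exponent_val r (d i))%:E = (exponent_val r e)%:E.
  move=> rep; have [i [fi mini]] := leads_rep f0 rep.
  rewrite (leads_uniq fe fi); apply: le_anti; apply/andP; split.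
    exact: Order.TotalTheory.bigmin_le.
  apply: Order.POrderTheory.le_bigmin => [|j _]; first exact: leey.
  by rewrite lee_fin.
apply: xget_unique => [|t [n [u [d [rep ->]]]]]; last exact: val_rep rep.
have [n [u [d rep]]] := monomial_rep_exists hD f0.
by exists n, u, d; split=> //; rewrite (val_rep _ _ _ rep).
Qed.

Local Notation vD := (monomial_valD x y r).

Lemma monomial_valD0 : vD 0 = +oo%E.
Proof. by rewrite /monomial_valD eqxx. Qed.

Lemma monomial_valD_fin f : f != 0 -> exists t, vD f = t%:E.
Proof.
by move=> /leads_exists [e fe]; exists (exponent_val r e); apply: monomial_valD_leads.
Qed.

Lemma monomial_valD_nNy f : vD f != -oo%E.
Proof.
have [->|/monomial_valD_fin [t ->]//] := eqVneq f 0.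
by rewrite monomial_valD0.
Qed.

Lemma monomial_valDM f g : (vD (f * g) = vD f + vD g)%E.
Proof.
have [->|f0] := eqVneq f 0.
  by rewrite mul0r monomial_valD0 addye // monomial_valD_nNy.
have [->|g0] := eqVneq g 0.
  by rewrite mulr0 monomial_valD0 addey // monomial_valD_nNy.
have [e fe] := leads_exists f0; have [d gd] := leads_exists g0.
by rewrite (monomial_valD_leads (leadsM fe gd)) exponent_valD
  (monomial_valD_leads fe) (monomial_valD_leads gd).
Qed.

(** If the leading monomial of f + g came before those of f and g, both f and g
    would be in the ideal of the monomials that follow it. *)
Lemma monomial_valDD f g : (Order.min (vD f) (vD g) <= vD (f + g))%E.
Proof.
have [->|f0] := eqVneq f 0; first by rewrite add0r ge_min lexx orbT.
have [->|g0] := eqVneq g 0; first by rewrite addr0 ge_min lexx.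
have [->|fg0] := eqVneq (f + g) 0; first by rewrite monomial_valD0 leey.
have [[e fe] [d gd]] := (leads_exists f0, leads_exists g0).
have [k fgk] := leads_exists fg0.
rewrite !(monomial_valD_leads fe, monomial_valD_leads gd, monomial_valD_leads fgk).
rewrite leNgt lt_min !lte_fin; apply/negP => /andP[lt_ke lt_kd].
apply: (leads_not_above fgk); apply: above_add.
  by apply: leads_above fe; rewrite precedesE lt_ke.
by apply: leads_above gd; rewrite precedesE lt_kd.
Qed.

Lemma monomial_valD_ge0 f : (0 <= vD f)%E.
Proof.
have [->|/leads_exists [e fe]] := eqVneq f 0; first by rewrite monomial_valD0 leey.
rewrite (monomial_valD_leads fe) lee_fin /exponent_val addr_ge0 //.
by rewrite mulr_ge0 // ltW.
Qed.

Lemma monomial_valD_unit u : u \is a GRing.unit -> vD u = 0%E.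
Proof.
move=> /leads_unit /monomial_valD_leads ->.
by rewrite /exponent_val /= mul0r addr0.
Qed.

Lemma monomial_valD_nunit f : f \isn't a GRing.unit -> (0 < vD f)%E.
Proof.
have [->|/leads_exists [[p q] fe] nuf] := eqVneq f 0; first by rewrite monomial_valD0 ltry.
rewrite (monomial_valD_leads fe) lte_fin /exponent_val /=.
have : (p + q != 0)%N.
  apply: contra nuf; rewrite addn_eq0 => /andP[/eqP p0 /eqP q0].
  case: fe => u uu; rewrite p0 q0 /monomial !mulr1 => /above_corner[a [b]] /=.
  rewrite !expr1 => fu; have -> : f = u - ((- a) * x + (- b) * y).
    by rewrite !mulNr -opprD opprK -fu; ring.
  exact: unit_sub_max.
case: p {fe} => [|p]; last first.
  by move=> _; rewrite ltr_pwDl // mulr_ge0 // ltW.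
by case: q => // q _; rewrite add0r mulr_gt0.
Qed.

End LeadingExponents.

(** * The valuation on the quotient field *)

Lemma frac_repr (D : idomainType) (z : {fraction D}) :
  exists f g : D, g != 0 /\ z = tofrac f / tofrac g.
Proof.
elim/quotW: z => a; exists (frac a).1, (frac a).2.
have d0 := denom_ratioP a; split=> //.
have d0' : tofrac (frac a).2 != 0 by rewrite tofrac_eq0.
apply: (mulIf d0'); rewrite mulfVK //.
change (FracField.mul (\pi_{fraction D}%qT a) (tofrac (frac a).2) =
        tofrac (frac a).1).
rewrite !piE /FracField.mulf; apply/eqmodP => /=.
by rewrite FracField.equivfE !numden_Ratio ?oner_eq0 ?mulf_neq0 ?oner_neq0 //
  !mulr1 mulrC.
Qed.

(** Multiplying a relation 1 + c_0 z^-1 + ... + c_n z^-(n+1) by z^(n+1) / c_n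
    exhibits 1 up to a multiple of z, with no negative power left. *)
Lemma clear_inverse_powers (F : fieldType) (z e : F) (c : nat -> F) n :
    z != 0 -> e * c n = 1 ->
  z * - (e * z ^+ n + \sum_(i < n) e * c i * z ^+ (n - i.+1)) - 1 =
  - (e * z ^+ n.+1 * (1 + \sum_(i < n.+1) c i * z^-1 ^+ i.+1)).
Proof.
move=> z0 ec; rewrite big_ord_recr /=; set S := \sum_(i < n) _; set T := \sum_(i < n) _.
have zST : z * S = e * z ^+ n.+1 * T.
  rewrite !mulr_sumr; apply: eq_bigr => i _.
  have -> : z ^+ n.+1 = z ^+ (n - i.+1) * z * z ^+ i.+1.
    by rewrite -exprSr -exprD; congr (_ ^+ _); have := ltn_ord i; lia.
  by rewrite exprVn; field; apply: expf_neq0.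
have -> : e * z ^+ n.+1 * (1 + (T + c n * z^-1 ^+ n.+1)) =
    e * z ^+ n.+1 + e * z ^+ n.+1 * T + e * c n.
  by rewrite exprVn; field; apply: expf_neq0.
by rewrite -zST ec exprS; ring.
Qed.

Section ValuationOnFractions.
Variables (R : realType) (D : idomainType) (x y : D).
Hypothesis hD : regular_system_of_parameters [:: x; y].

Section FixedSlope.
Variable r : R.
Hypothesis r_gt0 : 0 < r.

Local Notation vD := (monomial_valD x y r).
Local Notation vK := (monomial_valK x y r).
Local Notation V := (valuation_ring_r x y r).
Local Notation M := (max_ideal_r x y r).

Lemma monomial_valK_frac f g : g != 0 ->
  vK (tofrac f / tofrac g) = (vD f - vD g)%E.
Proof.
move=> g0; apply: xget_unique => [|t [f' [g' [g'0 E ->]]]]; first by exists f, g.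
have fg : f' * g = f * g'.
  apply/eqP; rewrite -tofrac_eq !tofracM; apply/eqP.
  have [tg0 tg'0] : tofrac g != 0 /\ tofrac g' != 0 by rewrite !tofrac_eq0.
  rewrite -[tofrac f'](mulfVK tg'0) -E -[in RHS](mulfVK tg0 (tofrac f)).
  by ring.
have /(congr1 vD) := fg; rewrite !(monomial_valDM hD r_gt0).
have [b ->] := monomial_valD_fin hD r_gt0 g0.
have [b' ->] := monomial_valD_fin hD r_gt0 g'0.
have := monomial_valD_nNy hD r_gt0 f; have := monomial_valD_nNy hD r_gt0 f'.
case: (vD f) => [a| |] //; case: (vD f') => [a'| |] //= _ _ [E'].
by congr EFin; apply/eqP; rewrite subr_eq addrAC eq_sym subr_eq -E'.
Qed.

Lemma monomial_valKM z w : vK (z * w) = (vK z + vK w)%E.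
Proof.
have [[f [g [g0 ->]]] [h [k [k0 ->]]]] := (frac_repr z, frac_repr w).
rewrite mulf_div -!tofracM !monomial_valK_frac ?mulf_neq0 //.
rewrite !(monomial_valDM hD r_gt0).
have [b ->] := monomial_valD_fin hD r_gt0 g0.
have [d ->] := monomial_valD_fin hD r_gt0 k0.
have := monomial_valD_nNy hD r_gt0 f; have := monomial_valD_nNy hD r_gt0 h.
case: (vD f) => [a| |] //; case: (vD h) => [c| |] //= _ _.
by congr EFin; ring.
Qed.

Lemma monomial_valKD z w : (Order.min (vK z) (vK w) <= vK (z + w)%R)%E.
Proof.
have [[f [g [g0 ->]]] [h [k [k0 ->]]]] := (frac_repr z, frac_repr w).
have [tg0 tk0] : tofrac g != 0 /\ tofrac k != 0 by rewrite !tofrac_eq0.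
have -> : tofrac f / tofrac g = tofrac (f * k) / tofrac (g * k).
  by rewrite !tofracM -mulf_div divff // mulr1.
have -> : tofrac h / tofrac k = tofrac (h * g) / tofrac (g * k).
  by rewrite !tofracM [tofrac g * _]mulrC -mulf_div divff // mulr1.
rewrite -mulrDl -tofracD !monomial_valK_frac ?mulf_neq0 //.
have [b ->] := monomial_valD_fin hD r_gt0 (mulf_neq0 g0 k0).
have := monomial_valDD hD r_gt0 (f * k) (h * g).
by rewrite !ge_min => /orP[] le; apply/orP; [left|right]; apply: leeB.
Qed.

Lemma monomial_valK_tofrac f : vK (tofrac f) = vD f.
Proof.
rewrite -[tofrac f]divr1 -tofrac1 monomial_valK_frac ?oner_neq0 //.
by rewrite (monomial_valD_unit hD r_gt0 (unitr1 D)) sube0.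
Qed.

Lemma monomial_valK0 : vK 0 = +oo%E.
Proof. by rewrite -tofrac0 monomial_valK_tofrac monomial_valD0. Qed.

Lemma monomial_valK_unit u : u \is a GRing.unit -> vK (tofrac u) = 0%E.
Proof. by move=> uu; rewrite monomial_valK_tofrac (monomial_valD_unit hD). Qed.

Lemma monomial_valK1 : vK 1 = 0%E.
Proof. by rewrite -tofrac1 monomial_valK_unit ?unitr1. Qed.

Lemma monomial_valKN z : vK (- z) = vK z.
Proof.
rewrite -mulN1r monomial_valKM -tofrac1 -tofracN monomial_valK_unit ?add0e //.
by rewrite unitrN unitr1.
Qed.

Lemma monomial_valKV z : z != 0 -> vK z^-1 = (- vK z)%E.
Proof.
move=> z0; have := monomial_valK1; rewrite -(mulfV z0) monomial_valKM.
have [f [g [g0 zE]]] := frac_repr z.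
have f0 : f != 0.
  by apply: contra_neq z0 => f0; rewrite zE f0 tofrac0 mul0r.
have [a va] := monomial_valD_fin hD r_gt0 f0.
have [b vb] := monomial_valD_fin hD r_gt0 g0.
have -> : vK z = (a - b)%:E by rewrite zE monomial_valK_frac // va vb.
case: (vK z^-1) => [c| |] //= [E].
by congr EFin; apply/eqP; rewrite -addr_eq0 addrC E.
Qed.

Lemma max_idealD z w : M z -> M w -> M (z + w).
Proof.
by move=> /= Mz Mw; apply: lt_le_trans (monomial_valKD z w); rewrite lt_min Mz.
Qed.

Lemma max_idealN z : M z -> M (- z).
Proof. by rewrite /max_ideal_r /= monomial_valKN. Qed.

Lemma max_idealMl z w : V z -> M w -> M (z * w).
Proof.
rewrite /valuation_ring_r /max_ideal_r /= monomial_valKM.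
case: (vK z) => [a| |] //; case: (vK w) => [b| |] //.
by rewrite lee_fin !lte_fin; apply: ltr_wpDl.
Qed.

Lemma valuation_ring_rM z w : V z -> V w -> V (z * w).
Proof. by rewrite /valuation_ring_r /= monomial_valKM; apply: adde_ge0. Qed.

Lemma valuation_ring_r_subring : subring_of V.
Proof.
apply/subring_ofP; split; first by rewrite /valuation_ring_r /= monomial_valK1.
  move=> u v /= Vu Vv; apply: le_trans (monomial_valKD u (- v)).
  by rewrite le_min monomial_valKN Vu.
exact: valuation_ring_rM.
Qed.

Lemma max_ideal_notV z : ~ V z -> M z^-1.
Proof.
rewrite /valuation_ring_r /max_ideal_r /=.
have [->|z0] := eqVneq z 0; first by rewrite monomial_valK0 leey.
by move=> /negP; rewrite -ltNge monomial_valKV // oppe_gt0.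
Qed.

Lemma max_ideal_sub : M `<=` V.
Proof. by move=> z /ltW. Qed.

Lemma valuation_ring_rP : valuation_ring V.
Proof.
split=> [|z z0]; first exact: valuation_ring_r_subring.
have [Vz|nVz] := pselect (V z); [by left|right].
by apply: max_ideal_sub; apply: max_ideal_notV.
Qed.

Lemma max_ideal0 : M 0.
Proof. by rewrite /max_ideal_r /= monomial_valK0 ltry. Qed.

Lemma max_ideal1 : ~ M 1.
Proof. by rewrite /max_ideal_r /= monomial_valK1 ltxx. Qed.

Lemma valuation_ring_r_inv z : V z -> ~ M z -> V z^-1.
Proof.
move=> Vz nMz; apply: contrapT => /max_ideal_notV; by rewrite invrK.
Qed.

Lemma valuation_ring_r_tofrac f : V (tofrac f).
Proof. by rewrite /valuation_ring_r /= monomial_valK_tofrac (monomial_valD_ge0 hD). Qed.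

Lemma max_ideal_nunit f : f \isn't a GRing.unit -> M (tofrac f).
Proof. by move=> nuf; rewrite /max_ideal_r /= monomial_valK_tofrac (monomial_valD_nunit hD). Qed.

(** The inverse of a nonzero element of M is not in V, hence not in W. *)
Lemma max_ideal_sub_overring (W : set {fraction D}) :
  valuation_ring W -> W `<=` V -> M `<=` W.
Proof.
move=> [hW vW] WV z Mz; have [->|z0] := eqVneq z 0; first exact: subring0.
have [//|/WV Vz] := vW z z0; case: max_ideal1.
by rewrite -(mulVf z0); apply: max_idealMl.
Qed.

Lemma max_ideal_sum n (F : nat -> {fraction D}) :
  (forall i, (i < n)%N -> M (F i)) -> M (\sum_(i < n) F i).
Proof.
move=> MF; apply: big_ind => [||i _]; [exact: max_ideal0|exact: max_idealD|exact: MF].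
Qed.

(** The relation says that the residue of z^-1 is algebraic over the residue field
    of D.  Top coefficients that are nonunits of D can be dropped since they are
    in M; the constant term 1 prevents all of them from being dropped. *)
Lemma unit_mod_max_of_relation (S : set {fraction D}) z (n : nat) (d : nat -> D) :
    subring_of S -> range (@tofrac D) `<=` S -> S z -> V z -> ~ M z ->
    M (1 + \sum_(i < n) tofrac (d i) * z^-1 ^+ i.+1) ->
  exists2 t, S t & M (z * t - 1).
Proof.
move=> hS DS Sz Vz nMz; have Vw := valuation_ring_r_inv Vz nMz.
have z0 : z != 0 by apply: contra_notN nMz => /eqP->; apply: max_ideal0.
elim: n => [|n IH]; first by rewrite big_ord0 addr0 => /max_ideal1.
rewrite big_ord_recr /= addrA; set s := 1 + _ => Ms.
have [ud|nud] := boolP (d n \is a GRing.unit); last first.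
  apply: IH; rewrite -/s; have -> : s = (s + tofrac (d n) * z^-1 ^+ n.+1) +
      - (z^-1 ^+ n.+1 * tofrac (d n)) by ring.
  apply: max_idealD => //; apply/max_idealN/max_idealMl.
    exact: (subringX valuation_ring_r_subring).
  exact: max_ideal_nunit.
pose e := tofrac (d n)^-1.
have ed : e * tofrac (d n) = 1 by rewrite -tofracM mulVr ?tofrac1.
have De a : S (tofrac a) by apply: DS; exists a.
exists (- (e * z ^+ n + \sum_(i < n) e * tofrac (d i) * z ^+ (n - i.+1))).
  apply: subringN => //; apply: subringD => //.
    exact: (subringM hS (De _) (subringX hS n Sz)).
  apply: (subring_sum hS (F := fun i => e * tofrac (d i) * z ^+ (n - i.+1))) => i _.
  exact: (subringM hS (subringM hS (De _) (De _)) (subringX hS _ Sz)).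
rewrite (clear_inverse_powers (c := fun i => tofrac (d i))) // big_ord_recr /= addrA -/s.
apply/max_idealN/max_idealMl => //; apply: valuation_ring_rM.
  exact: valuation_ring_r_tofrac.
exact: (subringX valuation_ring_r_subring).
Qed.

End FixedSlope.
End ValuationOnFractions.

(** * The interval ring *)

(** Connectedness of [a, b], by taking the supremum of the points up to which P
    keeps its value at a. *)
Lemma segment_locally_constant (R : realType) (a b : R) (P : R -> Prop) :
    (forall r, r \in `[a, b] -> exists2 e, 0 < e &
      forall s, s \in `[a, b] -> `|s - r| < e -> (P r <-> P s)) ->
  forall s t, s \in `[a, b] -> t \in `[a, b] -> P s -> P t.
Proof.
move=> locP; suff Pa t : t \in `[a, b] -> (P a <-> P t).
  by move=> s t /Pa[_ Ps] /Pa[Pt _] /Ps.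
move=> tab; have leab : a <= b by move: tab; rewrite in_itv /= => /andP[]; apply: le_trans.
have aab : a \in `[a, b] by rewrite in_itv /= lexx.
pose E := [set c | c \in `[a, b] /\ forall u, u \in `[a, b] -> u <= c -> (P a <-> P u)].
have Ea : E a.
  split=> // u; rewrite in_itv /= => /andP[leau _] leua.
  by have -> : u = a by apply: le_anti; rewrite leua.
have ubE : ubound E b by move=> c [+ _]; rewrite in_itv /= => /andP[].
have supE : has_sup E by split; [exists a|exists b].
have cab : sup E \in `[a, b].
  by rewrite in_itv /= (ub_le_sup supE.2 Ea) ge_sup //; exists a.
have [e e0 Pe] := locP _ cab.
have [d [dab Ed] ltd] := sup_adherent e0 supE.
have led : d <= sup E by apply: (ub_le_sup supE.2).
have Pac : P a <-> P (sup E).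
  apply: iff_trans (Ed d dab (lexx _)) _; apply: iff_sym; apply: Pe => //.
  by rewrite distrC ger0_norm; lra.
have Pnear u : u \in `[a, b] -> u < sup E + e -> (P a <-> P u).
  move=> uab ltu; have [leud|ltdu] := leP u d; first exact: Ed.
  apply: iff_trans Pac _; apply: Pe => //.
  by rewrite ltr_norml; apply/andP; split; lra.
apply: (Pnear) => //; rewrite ltNge; apply/negP => le_t.
have : E (sup E + e / 2).
  split=> [|u uab leu]; last by apply: Pnear => //; lra.
  move: cab tab; rewrite !in_itv /= => /andP[lac lcb] /andP[lat ltb].
  by apply/andP; split; lra.
by move/(ub_le_sup supE.2); lra.
Qed.

Section IntervalRing.
Variables (R : realType) (D : idomainType) (x y : D).
Hypothesis hD : regular_system_of_parameters [:: x; y].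

(** A representation of f is independent of r, and each of its exponents
    contributes an affine function of r with slope at most Q. *)
Lemma monomial_valD_lipschitz f : f != 0 -> exists2 Q : R, 0 <= Q &
  forall r s a b, 0 < r -> 0 < s ->
    monomial_valD x y r f = a%:E -> monomial_valD x y s f = b%:E ->
  a <= b + Q * `|s - r|.
Proof.
move=> f0; have [n [u [e rep]]] := monomial_rep_exists hD f0.
exists (\sum_i (e i).2%:R) => [|r s a b r0 s0]; first exact: sumr_ge0.
have [i [fi mini]] := leads_rep r f0 rep.
have [j [fj _]] := leads_rep s f0 rep.
rewrite (monomial_valD_leads hD r0 fi) (monomial_valD_leads hD s0 fj).
move=> [<-] [<-]; apply: le_trans (mini j) _.
have -> : exponent_val r (e j) = exponent_val s (e j) + (e j).2%:R * (r - s).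
  by rewrite /exponent_val; ring.
rewrite lerD2l; apply: le_trans (ler_norm _) _.
rewrite normrM distrC (ger0_norm (ler0n _ _)) ler_wpM2r //.
by rewrite (bigD1 j) //= lerDl sumr_ge0.
Qed.

Lemma max_ideal_r_open z (r : R) : 0 < r -> max_ideal_r x y r z ->
  exists2 e, 0 < e &
    forall s, 0 < s -> `|s - r| < e -> max_ideal_r x y s z.
Proof.
move=> r0; have [f [g [g0 ->]]] := frac_repr z; rewrite /max_ideal_r /=.
rewrite (monomial_valK_frac hD r0) //.
have [->|f0] := eqVneq f 0.
  move=> _; exists 1 => // s s0 _; rewrite tofrac0 mul0r.
  by rewrite (monomial_valK0 hD s0) ltry.
have [Qf Qf0 lipf] := monomial_valD_lipschitz f0.
have [Qg Qg0 lipg] := monomial_valD_lipschitz g0.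
have [a va] := monomial_valD_fin hD r0 f0; have [b vb] := monomial_valD_fin hD r0 g0.
rewrite va vb -EFinB lte_fin subr_gt0 => ltba.
have Q0 : 0 < Qf + Qg + 1 by lra.
exists ((a - b) / (Qf + Qg + 1)) => [|s s0]; first by rewrite divr_gt0 // subr_gt0.
rewrite ltr_pdivlMr // => lts; rewrite (monomial_valK_frac hD s0) //.
have [a' va'] := monomial_valD_fin hD s0 f0; have [b' vb'] := monomial_valD_fin hD s0 g0.
rewrite va' vb' -EFinB lte_fin subr_gt0.
have := lipf _ _ _ _ r0 s0 va va'; have := lipg _ _ _ _ s0 r0 vb' vb.
rewrite distrC => lg lf; have := normr_ge0 (s - r).
move: lts lg lf; set d := `|s - r|; rewrite !mulrDr mulr1 [d * Qf]mulrC [d * Qg]mulrC.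
set p := Qf * d; set q := Qg * d; lra.
Qed.

Variables (a b : R).
Hypothesis ha : 0 < a.

Local Notation T := (interval_ring x y `[a, b]).
Local Notation V := (valuation_ring_r x y).
Local Notation M := (max_ideal_r x y).

Lemma segment_gt0 r : r \in `[a, b] -> 0 < r.
Proof. by rewrite in_itv /= => /andP[lear _]; apply: lt_le_trans lear. Qed.

Lemma interval_ring_sub r : r \in `[a, b] -> T `<=` V r.
Proof.
move=> Ir z; apply; have r0 := segment_gt0 Ir; split; last by exists r.
  exact: valuation_ring_rP.
by move=> _ [f _ <-]; apply: valuation_ring_r_tofrac.
Qed.

Lemma interval_ring_subring : subring_of T.
Proof.
apply/subring_ofP; split.
- by move=> W [[hW _] _ _]; apply: subring1.
- by move=> u v Tu Tv W hW; case: (hW) => -[hW' _] _ _; apply: subringB; [|exact: Tu|exact: Tv].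
- by move=> u v Tu Tv W hW; case: (hW) => -[hW' _] _ _; apply: subringM; [|exact: Tu|exact: Tv].
Qed.

Lemma interval_ring_tofrac : range (@tofrac D) `<=` T.
Proof. by move=> f Df W [_ DW _]; apply: DW. Qed.

(** A valuation ring W that contains (D + M_r)[z^-1] and omits z would be one of
    those defining T; hence z is a polynomial in z^-1 over D + M_r. *)
Lemma inverse_mod_max_ideal r z : r \in `[a, b] -> T z -> ~ M r z ->
  exists2 t, T t & M r (z * t - 1).
Proof.
move=> Ir Tz nMz; have r0 := segment_gt0 Ir; have Vz := interval_ring_sub Ir Tz.
have z0 : z != 0 by apply: contra_notN nMz => /eqP->; apply: max_ideal0.
have Vw := valuation_ring_r_inv hD r0 Vz nMz.
have hV := valuation_ring_r_subring hD r0.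
pose A : set {fraction D} := [set c | exists d, M r (c - tofrac d)].
have MA : M r `<=` A by move=> c Mc; exists 0; rewrite tofrac0 subr0.
have hA : subring_of A.
  apply/subring_ofP; split.
  - by exists 1; rewrite tofrac1 subrr; apply: max_ideal0.
  - move=> u v [c Mc] [d Md]; exists (c - d); rewrite tofracB.
    have -> : u - v - (tofrac c - tofrac d) = (u - tofrac c) - (v - tofrac d) by ring.
    by apply: max_idealD => //; apply: max_idealN.
  - move=> u v [c Mc] [d Md]; exists (c * d); rewrite tofracM.
    have -> : u * v - tofrac c * tofrac d =
        v * (u - tofrac c) + tofrac c * (v - tofrac d) by ring.
    have Vv : V r v.
      rewrite -[v](subrK (tofrac d)); apply: subringD => //; last exact: valuation_ring_r_tofrac.
      exact: max_ideal_sub.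
    apply: max_idealD => //; apply: max_idealMl => //; exact: valuation_ring_r_tofrac.
have [n _ [c Ac zc]] : adjoin A z^-1 z.
  apply: contrapT => nz.
  have [W [hW AW nWz]] :=
    valuation_ring_avoiding (adjoin_subring z^-1 hA) (adjoin_gen z^-1 hA) nz.
    (* W lies inside V_r: if u is in W but not in V_r, then z = u (u^-1 z) with
     u^-1 z in M_r, so z would be in W. *)
have {}AW : A `<=` W := subset_trans (sub_adjoin _ hA) AW.
  apply: (nWz); apply: Tz; split=> //.
    by move=> _ [d _ <-]; apply: AW; exists d; rewrite subrr; apply: max_ideal0.
  exists r => // u Wu; apply: contrapT => nVu; have Mu := max_ideal_notV hD r0 nVu.
  apply: nWz; have u0 : u != 0.
    by apply: contra_notN nVu => /eqP->; apply: subring0.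
  rewrite -[z](mulVKf u0); apply: (subringM hW.1) => //.
  by apply: AW; apply: MA; rewrite mulrC; apply: max_idealMl.
have [d Md] := choice Ac.
apply: (@unit_mod_max_of_relation _ _ _ _ hD _ r0 T z n (fun i => - d i)) => //.
- exact: interval_ring_subring.
- exact: interval_ring_tofrac.
have one : 1 = \sum_(i < n) c i * z^-1 ^+ i.+1.
  rewrite -[LHS](mulVf z0) [X in _ * X]zc mulr_sumr; apply: eq_bigr => i _.
  by rewrite mulrCA -exprS.
have -> : 1 + \sum_(i < n) tofrac (- d i) * z^-1 ^+ i.+1 =
    \sum_(i < n) z^-1 ^+ i.+1 * (c i - tofrac (d i)).
  rewrite one -big_split; apply: eq_bigr => i _.
  by rewrite /= tofracN [RHS]mulrC mulrBl mulNr.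
apply: (max_ideal_sum hD r0 (F := fun i => z^-1 ^+ i.+1 * (c i - tofrac (d i)))) => i _.
by apply: max_idealMl => //; apply: subringX.
Qed.

(** Membership of z in M_r is an open condition on r, and so is its negation,
    witnessed by z t - 1 being in M_r for some t in T. *)
Lemma max_ideal_slope_indep r s z : r \in `[a, b] -> s \in `[a, b] -> T z ->
  M r z -> M s z.
Proof.
move=> Ir Is Tz; apply: (@segment_locally_constant _ a b (fun r => M r z)) => // {r s Ir Is} r Ir.
have r0 := segment_gt0 Ir.
have [Mr|nMr] := pselect (M r z).
  have [e e0 Me] := max_ideal_r_open r0 Mr; exists e => // t It lt_t.
  by split=> // _; apply: Me => //; apply: segment_gt0.
have [t Tt Mt] := inverse_mod_max_ideal Ir Tz nMr.
have [e e0 Me] := max_ideal_r_open r0 Mt; exists e => // u Iu lt_u.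
have u0 := segment_gt0 Iu; split=> // Mu; case: (@max_ideal1 _ _ _ _ hD _ u0).
have -> : 1 = t * z + - (z * t - 1) by ring.
apply: max_idealD => //; last by apply: max_idealN => //; apply: Me.
by apply: max_idealMl => //; apply: interval_ring_sub Iu _ Tt.
Qed.

Lemma interval_ring_inverse z : T z -> ~ (\bigcap_(r in `[a, b]) M r) z -> T z^-1.
Proof.
move=> Tz nMz W hW; case: (hW) => vW DW [r Ir WV]; have r0 := segment_gt0 Ir.
have nMr : ~ M r z by move=> Mr; apply: nMz => s Is; apply: max_ideal_slope_indep Ir Is Tz Mr.
have [t Tt Mt] := inverse_mod_max_ideal Ir Tz nMr.
have MW := max_ideal_sub_overring hD r0 vW WV.
set p := z * t in Mt.
have nMp : ~ M r p.
  move=> Mp; case: (@max_ideal1 _ _ _ _ hD _ r0).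
  have -> : 1 = p + - (p - 1) by ring.
  by apply: max_idealD => //; apply: max_idealN.
have p0 : p != 0 by apply: contra_notN nMp => /eqP->; apply: max_ideal0.
have Vp : V r p.
  apply: (interval_ring_sub Ir); exact: subringM interval_ring_subring _ _ Tz Tt.
have Wp : W p^-1.
  have -> : p^-1 = 1 - p^-1 * (p - 1) by rewrite mulrBr mulVf // mulr1 opprB addrC subrK.
  apply: subringB => //; [exact: vW.1|exact: subring1 vW.1|].
  by apply: MW; apply: max_idealMl => //; apply: valuation_ring_r_inv.
have [z0 t0] : z != 0 /\ t != 0 by apply/andP; rewrite -negb_or -mulf_eq0.
have -> : z^-1 = t * p^-1 by rewrite /p invfM mulrCA mulfV // mulr1.
by apply: subringM => //; [exact: vW.1|apply: Tt].
Qed.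

Lemma max_ideal_interval : ideal_of T (\bigcap_(r in `[a, b]) M r).
Proof.
split.
- move=> z Mz W [vW DW [r Ir WV]]; have r0 := segment_gt0 Ir.
  by apply: (max_ideal_sub_overring hD r0 vW WV); apply: Mz.
- by move=> r Ir; exact: (max_ideal0 hD (segment_gt0 Ir)).
- by move=> u v Mu Mv r Ir; exact: (max_idealD hD (segment_gt0 Ir) (Mu r Ir) (Mv r Ir)).
- move=> c u Tc Mu r Ir.
  exact: (max_idealMl hD (segment_gt0 Ir) (interval_ring_sub Ir Tc) (Mu r Ir)).
Qed.

End IntervalRing.

Theorem mainTheorem1 (R : realType) (D : idomainType) (x y : D)
    (hD : regular_system_of_parameters [:: x; y])
    (a b : R) (ha : 0 < a) (hab : a < b) :
  local_ring (interval_ring x y `[a, b])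
             (\bigcap_(r in `[a, b]) max_ideal_r x y r).
Proof.
apply: local_ring_inverse.
- exact: interval_ring_subring.
- exact: max_ideal_interval.
- have Ia : a \in `[a, b] by rewrite in_itv /= lexx ltW.
  by move=> /(_ a Ia); exact: (max_ideal1 hD ha).
- exact: interval_ring_inverse.
Qed.
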